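(* Let $n\ge 2$ be an integer and let $I_n=(x(y^n-z^n),\,y(z^n-x^n),\,z(x^n-y^n))\subset \mathbb{C}[x,y,z]$ be the Fermat ideal. Then: (1) For all $n\ge 2$, $\alpha(I_n^{(2)})=\alpha(I_n^{2})=2(n+1)$. (2) $\alpha(I_2^{(2k)})=5k$ for all integers $k\ge 2$. (3) $\alpha(I_2^{(2k+1)})=5k+3$ for all integers $k\ge 0$. (4) $\alpha(I_3^{(3k)})=9k$ for all integers $k\ge 1$. (5) $\alpha(I_3^{(3k+1)})=9k+4$ for all integers $k\ge 1$. (6) $\alpha(I_3^{(3k+2)})=9k+8$ for all integers $k\ge 1$. (7) $\alpha(I_4^{(m)})=4m$ for all integers $m\ge 3$ with $m\neq 5$, and $\alpha(I_4^{(5)})=21$. (8) For all $n\ge 5$, $\alpha(I_n^{(m)})=mn$ for all integers $m\ge 3$.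
   Context: Let $R=\mathbb{C}[x,y,z]$ with the standard grading. For a nonzero homogeneous ideal $J\subseteq R$, $\alpha(J)$ denotes the least degree of a nonzero homogeneous polynomial in $J$ (the initial degree). For a homogeneous ideal $I\subseteq R$ and an integer $m\ge 1$, the $m$-th symbolic power of $I$ is $I^{(m)}:=\bigcap_{\mathfrak{p}\in \mathrm{Ass}(R/I)} \left(I^mR_{\mathfrak{p}}\cap R\right)$. $I^m$ denotes the ordinary power. *)

(* Defs.v *)
From HB Require Import structures.
From mathcomp Require Import all_boot all_order all_algebra.
From mathcomp Require Import boolp classical_sets reals.
From mathcomp Require Import complex.
From mathcomp Require Import mpoly.

Set Implicit Arguments.
Unset Strict Implicit.
Unset Printing Implicit Defensive.

Import GRing.Theory.
Local Open Scope ring_scope.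
Local Open Scope classical_set_scope.

Section Ideals.
Variable A : idomainType.
Implicit Types (I P S : set A) (m : nat).

Definition ideal_gen S : set A :=
  [set f | exists (n : nat) (a s : 'I_n -> A),
     (forall i, S (s i)) /\ f = \sum_(i < n) a i * s i].

Definition ideal_pow I m : set A :=
  ideal_gen [set f | exists g : 'I_m -> A,
    (forall i, I (g i)) /\ f = \prod_(i < m) g i].

(* [idealr_closed] includes properness: it requires [1 \notin P]. *)
Definition prime_ideal P : Prop :=
  idealr_closed (mem P) /\ prime_idealr_closed (mem P).

(* The annihilator in [A] of the class of [f] in [A/I]. *)
Definition ann_quot I (f : A) : set A := [set g | I (g * f)].

(* Ass(A/I). *)
Definition Ass I : set (set A) :=
  [set P | prime_ideal P /\ exists f : A, P = ann_quot I f].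

(* The localization A_P, as a subring of the fraction field of the domain A. *)
Definition localization P : set {fraction A} :=
  [set u | exists a s : A, ~ P s /\ u = tofrac a / tofrac s].

(* The extended ideal I A_P. *)
Definition extension P I : set {fraction A} :=
  [set u | exists (n : nat) (c : 'I_n -> {fraction A}) (g : 'I_n -> A),
     [/\ forall i, localization P (c i),
         forall i, I (g i)
       & u = \sum_(i < n) c i * tofrac (g i)]].

(* I A_P \cap A, where A is embedded in its fraction field by [tofrac]. *)
Definition contracted_extension P I : set A :=
  @tofrac A @^-1` extension P I.

Definition symbolic_pow I m : set A :=
  \bigcap_(P in Ass I) contracted_extension P (ideal_pow I m).

End Ideals.

(* [initial_degree J d] is the assertion that alpha(J) exists and equals d. *)
Definition initial_degree (F : fieldType) (n : nat)
    (J : set {mpoly F[n]}) (d : nat) : Prop :=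
  (exists f : {mpoly F[n]}, [/\ J f, f != 0 & f \is d.-homog]) /\
  (forall (e : nat) (f : {mpoly F[n]}),
     J f -> f != 0 -> f \is e.-homog -> (d <= e)%N).

Definition fermat_ideal (F : fieldType) (n : nat) : set {mpoly F[3]} :=
  let x : {mpoly F[3]} := 'X_(@Ordinal 3 0 isT) in
  let y : {mpoly F[3]} := 'X_(@Ordinal 3 1 isT) in
  let z : {mpoly F[3]} := 'X_(@Ordinal 3 2 isT) in
  ideal_gen [set` [:: x * (y ^+ n - z ^+ n);
                      y * (z ^+ n - x ^+ n);
                      z * (x ^+ n - y ^+ n)]].
Arguments fermat_ideal : clear implicits.

(* Main.v *)
Require Import Defs.
From HB Require Import structures.
From mathcomp Require Import all_boot all_order all_algebra.
From mathcomp Require Import boolp classical_sets reals.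
From mathcomp Require Import complex.
From mathcomp Require Import mpoly.
From mathcomp Require Import separable cyclotomic.
From mathcomp Require Import ring zify.

Set Implicit Arguments.
Unset Strict Implicit.
Unset Printing Implicit Defensive.

Import GRing.Theory Num.Theory.
Local Open Scope ring_scope.

(* The scheme of I_n consists of the n^2 points with coordinates n-th roots of
   unity and the 3 coordinate points; I_n is saturated, so membership in a
   symbolic power can be tested at these points only.

   Lower bounds.  Each of the 3n lines X_j = c X_k with c^n = 1 passes through n
   of the n^2 points and one coordinate point.  If f has multiplicity a at the
   former, b at the latter, and degree < na+b, then all these lines divide f by
   Bezout, and the quotient has degree smaller by 3n and multiplicities a-3 and
   b-n.  With one pencil only, the same argument gives deg f >= na.  For n = 2,
   if deg f < 2b then also xyz divides f, which lowers b by 2.  Iterating these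
   reductions gives every lower bound.

   Upper bounds.  All extremal forms are products of powers of x, y, z and of
   y^n-z^n, z^n-x^n, x^n-y^n, whose multiplicities are explicit. *)

(** * Ideals and symbolic powers *)

Lemma cancel_denominator (K : fieldType) (a b s g : K) :
  b != 0 -> b * s * (a / b * g) = s * a * g.
Proof. by move=> b0; field. Qed.

Section IdealPowers.
Variable A : idomainType.
Implicit Types (S I J K P : set A) (f g h s : A) (k l m : nat).

(** Unlike [idealr_closed], this admits the unit ideal, which occurs as [ideal_pow I 0]. *)
Definition is_ideal K : Prop :=
  [/\ K 0, forall f g, K f -> K g -> K (f + g) & forall a f, K f -> K (a * f)].

Lemma ideal_sum K n (F : 'I_n -> A) :
  is_ideal K -> (forall i, K (F i)) -> K (\sum_(i < n) F i).
Proof. by case=> K0 KD _ KF; elim/big_ind: _. Qed.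

Lemma idealB K f g : is_ideal K -> K f -> K g -> K (f - g).
Proof. by case=> _ KD KM Kf Kg; rewrite -mulN1r; apply: KD => //; apply: KM. Qed.

Lemma ideal_gen_min S K :
  is_ideal K -> (forall s, S s -> K s) -> forall f, ideal_gen S f -> K f.
Proof.
move=> idK SK f [n [a [s [Ss ->]]]]; apply: ideal_sum => // i.
by case: idK => _ _ KM; apply: KM; apply: SK.
Qed.

Lemma ideal_gen_ideal S : is_ideal (ideal_gen S).
Proof.
split.
- exists 0%N, (fun=> 0), (fun=> 0); split; first by case.
  by rewrite big_ord0.
- move=> f g [n1 [a1 [s1 [S1 ->]]]] [n2 [a2 [s2 [S2 ->]]]].
  exists (n1 + n2)%N,
    (fun i => match split i with inl j => a1 j | inr j => a2 j end),
    (fun i => match split i with inl j => s1 j | inr j => s2 j end).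
  split; first by move=> i; case: (split i).
  rewrite big_split_ord /=; congr (_ + _); apply: eq_bigr => i _.
    by rewrite (unsplitK (inl i)).
  by rewrite (unsplitK (inr i)).
- move=> b f [n [a [s [Ss ->]]]]; exists n, (fun i => b * a i), s; split=> //.
  by rewrite mulr_sumr; apply: eq_bigr => i _; rewrite mulrA.
Qed.

Lemma sub_ideal_gen S s : S s -> ideal_gen S s.
Proof.
move=> Ss; exists 1%N, (fun=> 1), (fun=> s); split=> //.
by rewrite big_ord1 mul1r.
Qed.

Lemma ideal_pow_ideal I m : is_ideal (ideal_pow I m).
Proof. exact: ideal_gen_ideal. Qed.

Lemma ideal_pow_0 I f : ideal_pow I 0 f.
Proof.
rewrite -[f]mulr1; case: (ideal_pow_ideal I 0) => _ _; apply.
apply: sub_ideal_gen; exists (fun=> 0); split; first by case.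
by rewrite big_ord0.
Qed.

Lemma ideal_pow_1 I f : I f -> ideal_pow I 1 f.
Proof.
by move=> If; apply: sub_ideal_gen; exists (fun=> f); rewrite big_ord1.
Qed.

(** Membership is linear in [f] and in [g], so two applications of [ideal_gen_min] reduce to
    generators, whose lists of factors are concatenated. *)
Lemma ideal_powM I k l f g :
  ideal_pow I k f -> ideal_pow I l g -> ideal_pow I (k + l) (f * g).
Proof.
have [Z D M] := ideal_pow_ideal I (k + l).
move=> If Ig; move: f If; apply: ideal_gen_min.
  by split=> [|f f' If If'|a f If];
    rewrite ?mul0r ?mulrDl -?mulrA; [exact: Z|exact: D|exact: M].
move=> _ [u [Iu ->]]; move: g Ig; apply: ideal_gen_min.
  split=> [|f f' If If'|a f If]; rewrite ?mulr0 ?mulrDr 1?mulrCA;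
    [exact: Z|exact: D|exact: M].
move=> _ [v [Iv ->]]; apply: sub_ideal_gen.
exists (fun i => match split i with inl j => u j | inr j => v j end); split.
  by move=> i; case: (split i).
rewrite big_split_ord /=; congr (_ * _); apply: eq_bigr => i _.
  by rewrite (unsplitK (inl i)).
by rewrite (unsplitK (inr i)).
Qed.

Lemma ideal_pow_anti I k l f : (k <= l)%N -> ideal_pow I l f -> ideal_pow I k f.
Proof.
have idk := ideal_pow_ideal I k; move/subnK <-; move: f.
apply: ideal_gen_min => // _ [u [Iu ->]]; rewrite big_split_ord /=.
case: idk => _ _; apply; apply: sub_ideal_gen.
by exists (fun i => u (rshift _ i)).
Qed.

Lemma ideal_powX I k f : I f -> ideal_pow I k (f ^+ k).
Proof.
move=> If; apply: sub_ideal_gen; exists (fun=> f); split=> //.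
by rewrite prodr_const card_ord.
Qed.

Lemma prime_idealP P : prime_ideal P <->
  [/\ is_ideal P, ~ P 1 & forall u v, P (u * v) -> P u \/ P v].
Proof.
rewrite /prime_ideal /prime_idealr_closed; split.
  case=> -[]; rewrite !inE => P0 P1 PL PM; split=> //.
  - split=> // [f g Pf Pg|a f Pf].
      by have := PL 1 f g; rewrite !inE mul1r; apply.
    by have := PL a f 0; rewrite !inE addr0; apply.
  - by move: P1; rewrite notin_setE.
  - by move=> u v Puv; have := PM u v; rewrite !inE => /(_ Puv)/orP[]; rewrite inE; [left|right].
case=> -[P0 PD PM] P1 PP; split.
  split; rewrite ?inE ?notin_setE // => a u v; rewrite !inE => Pu Pv.
  by apply: PD => //; apply: PM.
by move=> u v; rewrite inE => /PP[]?; apply/orP; [left|right]; rewrite inE.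
Qed.

(** Finitely many elements of the localization have a common denominator: the product of their
    denominators, which stays outside [P] by primality. *)
Lemma contracted_extensionP P J f : prime_ideal P -> is_ideal J ->
  contracted_extension P J f <-> exists s, ~ P s /\ J (s * f).
Proof.
move=> /prime_idealP[[P0 PD PM] P1 PP] idJ; split.
  case=> n [c [g [Pc Jg fE]]].
  suff [s [Ps [h [Jh sE]]]] : exists s, ~ P s /\ exists h, J h /\
      tofrac s * (\sum_(i < n) c i * tofrac (g i)) = tofrac h.
    exists s; split=> //; move: sE; rewrite -fE -rmorphM /= => /eqP.
    by rewrite tofrac_eq => /eqP ->.
  elim: n c g Pc Jg {fE} => [|n IHn] c g Pc Jg.
    exists 1; split=> //; exists 0; rewrite big_ord0 mulr0 rmorph0.
    by split=> //; case: idJ.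
  have [i|i|s [Ps [h [Jh sE]]]] :=
    IHn (fun i => c (lift ord0 i)) (fun i => g (lift ord0 i)); first exact: Pc.
    exact: Jg.
  have [a [b [Pb cE]]] := Pc ord0.
  exists (b * s); split; first by case/PP.
  case: idJ => _ JD JM.
  exists (s * a * g ord0 + b * h); split; first by apply: JD; apply: JM.
  have b0 : tofrac b != 0 :> {fraction A}.
    by rewrite tofrac_eq0; apply: contra_notN Pb => /eqP ->.
  rewrite big_ord_recl mulrDr !rmorphD !rmorphM /= -[X in _ + X]mulrA sE cE.
  by congr (_ + _); apply: cancel_denominator.
case=> s [Ps Jsf]; exists 1%N, (fun=> tofrac 1 / tofrac s), (fun=> s * f).
split=> // [_|]; first by exists 1, s.
have s0 : tofrac s != 0 :> {fraction A}.
  by rewrite tofrac_eq0; apply: contra_notN Ps => /eqP ->.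
by rewrite big_ord1 rmorphM rmorph1 mul1r mulKf.
Qed.

(* [f \in I^k A_P], with the denominator cleared. *)
Definition local_pow P I k f : Prop := exists s, ~ P s /\ ideal_pow I k (s * f).

Section Local.
Variables P I : set A.
Hypothesis primeP : prime_ideal P.

Lemma local_pow_0 f : local_pow P I 0 f.
Proof.
by case/prime_idealP: primeP => _ P1 _; exists 1; split=> //; apply: ideal_pow_0.
Qed.

Lemma local_powM k l f g :
  local_pow P I k f -> local_pow P I l g -> local_pow P I (k + l) (f * g).
Proof.
case/prime_idealP: primeP => _ _ PP.
move=> [s [Ps Isf]] [t [Pt Itg]]; exists (s * t); split; first by case/PP.
by rewrite mulrACA; apply: ideal_powM.
Qed.

Lemma local_powX k i f : local_pow P I k f -> local_pow P I (i * k) (f ^+ i).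
Proof.
move=> If; elim: i => [|i IHi]; first exact: local_pow_0.
by rewrite exprS mulSn; apply: local_powM.
Qed.

Lemma local_pow_anti k l f : (k <= l)%N -> local_pow P I l f -> local_pow P I k f.
Proof.
by move=> kl [s [Ps Is]]; exists s; split=> //; apply: ideal_pow_anti Is.
Qed.

End Local.

Lemma symbolic_powP I m f :
  symbolic_pow I m f <-> forall P, Ass I P -> local_pow P I m f.
Proof.
split=> If P AP; have := If P AP; have pP : prime_ideal P by case: AP.
  by move/(contracted_extensionP _ pP (ideal_pow_ideal I m)).
by move=> ?; apply/(contracted_extensionP _ pP (ideal_pow_ideal I m)).
Qed.

Lemma sub_symbolic_pow I m f : ideal_pow I m f -> symbolic_pow I m f.
Proof.
move=> If; apply/symbolic_powP => P [/prime_idealP[_ P1 _] _].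
by exists 1; split=> //; rewrite mul1r.
Qed.

End IdealPowers.

(** * Prime elements *)

Section Divides.
Variable A : idomainType.
Implicit Types (a b p : A).

Definition divides p a : Prop := exists q, a = q * p.

Definition prime_elt p : Prop :=
  [/\ p != 0, ~ divides p 1 &
      forall a b, divides p (a * b) -> divides p a \/ divides p b].

Lemma divides_ideal p : is_ideal (divides p).
Proof.
split=> [|a b [u ->] [v ->]|a b [u ->]]; first by exists 0; rewrite mul0r.
  by exists (u + v); rewrite mulrDl.
by exists (a * u); rewrite mulrA.
Qed.

(** Such a [p] generates the kernel of a morphism into a domain, so the quotient by [p] embeds in a
    domain. *)
Lemma kernel_prime (B : idomainType) (phi : {rmorphism A -> B}) p :
  p != 0 -> phi p = 0 -> (forall a, phi a = 0 -> divides p a) -> prime_elt p.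
Proof.
move=> p0 phip ker; split=> // [[q qp]|a b [q abE]].
  by have /eqP := rmorph1 phi; rewrite qp rmorphM phip mulr0 eq_sym oner_eq0.
have /eqP : phi a * phi b = 0 by rewrite -rmorphM abE rmorphM phip mulr0.
by rewrite mulf_eq0 => /orP[]/eqP/ker; [left|right].
Qed.

(** One factor [p] at a time: it must divide what is left of [b], since it does not divide [a], and
    is then cancelled. *)
Lemma prime_eltX p m a b :
  prime_elt p -> ~ divides p a -> divides (p ^+ m) (a * b) -> divides (p ^+ m) b.
Proof.
move=> [p0 _ pP] pa; elim: m => [|m IHm].
  by move=> _; exists b; rewrite mulr1.
case=> q; rewrite exprS mulrA => abE.
have [|c bE] := IHm; first by exists (q * p).
have acE : a * c = q * p.
  by apply: (mulIf (expf_neq0 m p0)); rewrite -mulrA -bE.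
have [//|[d cE]] : divides p a \/ divides p c by apply: pP; exists q.
by exists d; rewrite bE cE mulrA.
Qed.

(** Induction on the list: the prime [l x] divides none of the prime powers already split off from
    [f], so its own power divides the cofactor. *)
Lemma prime_elt_prod (T : eqType) (s : seq T) (l : T -> A) (m : T -> nat) f :
  uniq s -> (forall x, x \in s -> prime_elt (l x)) ->
  (forall x y, x \in s -> y \in s -> x != y -> ~ divides (l x) (l y)) ->
  (forall x, x \in s -> divides (l x ^+ m x) f) ->
  divides (\prod_(x <- s) l x ^+ m x) f.
Proof.
elim: s => [|x s IHs] /=; first by rewrite big_nil => *; exists f; rewrite mulr1.
case/andP=> xs us ps ds fs.
have xys y : y \in s -> ~ divides (l x) (l y).
  move=> ys; apply: ds; rewrite ?in_cons ?eqxx ?ys ?orbT //.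
  by apply: contraNneq xs => ->.
have [g fE] : divides (\prod_(y <- s) l y ^+ m y) f.
  apply: IHs => // [y ys|y z ys zs|y ys]; first by apply: ps; rewrite in_cons ys orbT.
    by apply: ds; rewrite in_cons ?ys ?zs orbT.
  by apply: fs; rewrite in_cons ys orbT.
have px : prime_elt (l x) by apply: ps; rewrite in_cons eqxx.
have [h gE] : divides (l x ^+ m x) g.
  apply: (@prime_eltX _ _ (\prod_(y <- s) l y ^+ m y)) => //; last first.
    by rewrite mulrC -fE; apply: fs; rewrite in_cons eqxx.
  case: (px) => _ nx pP; elim: s xys {xs us ps ds fs IHs fE} => [|y s IHs] xys.
    by rewrite big_nil.
  rewrite big_cons => /pP[]; last first.
    by apply: IHs => z zs; apply: xys; rewrite in_cons zs orbT.
  elim: (m y) => [|k IHk]; first by rewrite expr0.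
  by rewrite exprS => /pP[|//]; apply: xys; rewrite in_cons eqxx.
by exists h; rewrite fE gE big_cons mulrA.
Qed.

End Divides.

(** * Morphisms out of a polynomial ring *)

Section Morphisms.
Variables (F : fieldType) (n : nat).
Implicit Types (f g : {mpoly F[n]}).

(** The polynomials on which [phi] and [psi] agree modulo [K] form a subring containing constants
    and variables. For [K] zero this gives [mmorph_ext]; for the multiples of a line, the remainder
    theorem [line_dvdB]. *)
Lemma mmorph_congr (B : idomainType) (phi psi : {rmorphism {mpoly F[n]} -> B})
    (K : set B) :
  is_ideal K -> (forall c, phi c%:MP = psi c%:MP) ->
  (forall i, K (phi 'X_i - psi 'X_i)) -> forall g, K (phi g - psi g).
Proof.
move=> [K0 KD KM] eqC eqX.
have eqM f g : K (phi f - psi f) -> K (phi g - psi g) ->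
    K (phi (f * g) - psi (f * g)).
  move=> Kf Kg; have -> : phi (f * g) - psi (f * g) =
      phi f * (phi g - psi g) + psi g * (phi f - psi f) by rewrite !rmorphM /=; ring.
  by apply: KD; apply: KM.
have eq1 : K (phi 1 - psi 1) by rewrite !rmorph1 subrr.
elim/mpolyind=> [|c m p _ _ IHp]; first by rewrite !rmorph0 subrr.
rewrite -mul_mpolyC !rmorphD opprD addrACA; apply: KD => //.
apply: (eqM); first by rewrite eqC subrr.
rewrite mpolyXE_id; apply: (big_ind (fun u => K (phi u - psi u))) => [//|u v|i _]; first exact: eqM.
elim: (m i) => [|k IHk].
  by rewrite expr0.
by rewrite exprS; exact: eqM.
Qed.

Lemma mmorph_ext (B : idomainType) (phi psi : {rmorphism {mpoly F[n]} -> B}) :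
  (forall c, phi c%:MP = psi c%:MP) -> (forall i, phi 'X_i = psi 'X_i) ->
  phi =1 psi.
Proof.
move=> eqC eqX g; apply/eqP; rewrite -subr_eq0; apply/eqP.
apply: (@mmorph_congr _ phi psi (fun b => b = 0)) => [|//|i].
  by split=> // [u v -> ->|u v ->]; rewrite ?addr0 ?mulr0.
by rewrite eqX subrr.
Qed.

(** For nonzero polynomials [msize] is the degree plus one, so each [q i] has degree at most one. *)
Lemma msize_linear_subst (k : nat) (q : 'I_n -> {mpoly F[k]}) g :
  (forall i, (msize (q i) <= 2)%N) -> (msize (mmap (@mpolyC k F) q g) <= msize g)%N.
Proof.
move=> q2; have mM (u v : {mpoly F[k]}) a b : (msize u <= a.+1)%N -> (msize v <= b.+1)%N ->
    (msize (u * v) <= (a + b).+1)%N.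
  move=> ua vb; have [->|u0] := eqVneq u 0; first by rewrite mul0r msize0.
  have [->|v0] := eqVneq v 0; first by rewrite mulr0 msize0.
  by rewrite msizeM // -subn1 leq_subLR add1n -addnS -addSn leq_add.
apply: leq_trans (msize_sum _ _ _) _; rewrite big_seq.
apply/bigmax_leqP_seq => m _ mg; apply: leq_trans (msize_mdeg_lt mg).
rewrite -[mdeg m]add0n; apply: (mM); first by rewrite msizeC; case: (_ != _).
rewrite mdegE /mmap1; elim/big_rec2: _ => [|i u v _ uv]; first by rewrite msize1.
apply: (mM) => //; elim: (m i) => [|l IHl]; first by rewrite msize1.
by rewrite exprS -[l.+1]add1n; apply: mM.
Qed.

Lemma msize_dhomog d f : f != 0 -> f \is d.-homog -> msize f = d.+1.
Proof.
by move=> f0 /dhomogP hf; rewrite -mlead_deg // hf // mlead_supp.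
Qed.

End Morphisms.

(** * Lines and orders of vanishing *)

(** The cyclic shift permutes the Fermat generators, so that one argument serves all three
    coordinates. *)
Definition nxt (j : 'I_3) : 'I_3 := ordS j.

Lemma nxt3 j : nxt (nxt (nxt j)) = j.
Proof. by apply/val_inj; case: j => -[|[|[|]]]. Qed.

Lemma nxt_neq j : (nxt j == j) = false.
Proof. by case: j => -[|[|[|]]]. Qed.

Lemma nxt2_neq j : (nxt (nxt j) == j) = false.
Proof. by case: j => -[|[|[|]]]. Qed.

Lemma nxtP (j a : 'I_3) : [\/ a = j, a = nxt j | a = nxt (nxt j)].
Proof.
have [->|aj] := eqVneq a j; first by constructor 1.
have [->|ak] := eqVneq a (nxt j); first by constructor 2.
constructor 3; apply/val_inj; move: aj ak.
by case: j a => -[|[|[|?]]] // ? [] [|[|[|?]]].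
Qed.

Lemma neq_nxt j : (j == nxt j) = false.
Proof. by rewrite eq_sym nxt_neq. Qed.

Lemma neq_nxt2 j : (j == nxt (nxt j)) = false.
Proof. by rewrite eq_sym nxt2_neq. Qed.

Definition nxtE := (nxt3, nxt_neq, nxt2_neq, neq_nxt, neq_nxt2, eqxx).

Section Lines.
Variable F : fieldType.
Local Notation R := {mpoly F[3]}.
Implicit Types (f g : R) (p : 'I_3 -> F) (x y : 'I_3 * F).

(** The pair [(j, c)] encodes the line X_j = c X_k with k = [nxt j]; [c = 0] gives a coordinate
    line. *)
Definition line x : R := 'X_x.1 - x.2 *: 'X_(nxt x.1).

(** Restriction to the line, kept inside [R] by eliminating one variable, so that divisors of the
    restriction can again be written as lines. *)
Definition line_subst x : R -> R :=
  mmap (@mpolyC 3 F) (fun a => if a == x.1 then x.2 *: 'X_(nxt x.1) else 'X_a).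

HB.instance Definition _ x := GRing.RMorphism.copy (line_subst x)
  (mmap (@mpolyC 3 F) (fun a => if a == x.1 then x.2 *: 'X_(nxt x.1) else 'X_a)).

Lemma line_substC x c : line_subst x c%:MP = c%:MP.
Proof. exact: mmapC. Qed.

Lemma line_substX x a :
  line_subst x 'X_a = if a == x.1 then x.2 *: 'X_(nxt x.1) else 'X_a.
Proof. by rewrite /line_subst mmapX mmap1U. Qed.

Lemma line_subst_line x : line_subst x (line x) = 0.
Proof.
rewrite /line rmorphB /= -mul_mpolyC rmorphM /= line_substC !line_substX !nxtE.
by rewrite mul_mpolyC subrr.
Qed.

Lemma line_dvdB x f : divides (line x) (f - line_subst x f).
Proof.
apply: (@mmorph_congr _ _ _ idfun (line_subst x) (divides (line x))) => [|c|a].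
- exact: divides_ideal.
- by rewrite /= line_substC.
rewrite /= line_substX; case: eqP => [->|_]; first by exists 1; rewrite mul1r.
by exists 0; rewrite subrr mul0r.
Qed.

Lemma line_subst_eq0 x f : line_subst x f = 0 -> divides (line x) f.
Proof. by move=> f0; have := line_dvdB x f; rewrite f0 subr0. Qed.

Lemma meval_line p x : (line x).@[p] = p x.1 - x.2 * p (nxt x.1).
Proof. by rewrite mevalB mevalZ !mevalXU. Qed.

Lemma line_ndvd p x g :
  p x.1 = x.2 * p (nxt x.1) -> g.@[p] != 0 -> ~ divides (line x) g.
Proof.
move=> px gp [q qE]; move: gp.
by rewrite qE mevalM meval_line px subrr mulr0 eqxx.
Qed.

Lemma line_neq0 x : line x != 0.
Proof.
apply/eqP => /(congr1 (meval (fun a => (a == x.1)%:R))).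
by rewrite meval_line meval0 eqxx nxt_neq mulr0 subr0 => /eqP; rewrite oner_eq0.
Qed.

Lemma line_prime x : prime_elt (line x).
Proof.
apply: (@kernel_prime _ _ (line_subst x)); first exact: line_neq0.
  exact: line_subst_line.
exact: line_subst_eq0.
Qed.

(** Each relative position of the two indices gets an explicit point on the first line and off the
    second. *)
Lemma line_distinct x y : x != y -> ~ divides (line x) (line y).
Proof.
case: x y => j s [k t] /=; have [->|->|->] := nxtP j k.
- rewrite xpair_eqE eqxx /= => st.
  apply: (@line_ndvd (fun a => if a == j then s else 1)) => /=.
    by rewrite !nxtE mulr1.
  by rewrite meval_line /= !nxtE mulr1 subr_eq0.
- move=> _; apply: (@line_ndvd
    (fun a => if a == j then s else if a == nxt j then 1 else 0)) => /=.
    by rewrite !nxtE mulr1.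
  by rewrite meval_line /= !nxtE mulr0 subr0 oner_eq0.
move=> _; apply: (@line_ndvd (fun a => if a == nxt (nxt j) then 1 else 0)) => /=.
  by rewrite !nxtE mulr0.
by rewrite meval_line /= !nxtE mulr0 subr0 oner_eq0.
Qed.

Lemma line_homog x : line x \is 1.-homog.
Proof.
have hX a : ('X_a : R) \is 1.-homog by rewrite dhomogX; apply/eqP; exact: mdeg1.
by apply: rpredB; [|apply: rpredZ]; apply: hX.
Qed.

Lemma prod_line_neq0 (s : seq ('I_3 * F)) (m : 'I_3 * F -> nat) :
  \prod_(x <- s) line x ^+ m x != 0.
Proof. by rewrite prodf_seq_neq0; apply/allP => x _; rewrite expf_neq0 ?line_neq0. Qed.

Lemma msize_prod_line s (m : 'I_3 * F -> nat) f :
  f != 0 -> msize (f * \prod_(x <- s) line x ^+ m x) = (msize f + \sum_(x <- s) m x)%N.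
Proof.
move=> f0; have lE k (x : 'I_3 * F) : msize (line x ^+ k) = k.+1.
  apply: msize_dhomog; first by rewrite expf_neq0 ?line_neq0.
  by have := dhomogMn k (line_homog x); rewrite mul1n.
elim: s => [|x s IHs]; first by rewrite !big_nil mulr1 addn0.
rewrite !big_cons mulrCA msizeM ?IHs ?lE ?expf_neq0 ?line_neq0 //.
  by rewrite addSn /= addnCA.
by rewrite mulf_neq0 ?prod_line_neq0.
Qed.

Lemma msize_line_subst x f : (msize (line_subst x f) <= msize f)%N.
Proof.
apply: msize_linear_subst => a; case: ifP => _; last by rewrite msizeX mdeg1.
by apply: leq_trans (msizeZ_le _ _) _; rewrite msizeX mdeg1.
Qed.

(* Bezout for a line: a nonzero restriction of [f] would have too large a degree. *)
Lemma line_dvd_of_subst x s (m : 'I_3 * F -> nat) f : uniq s ->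
  (forall y, y \in s -> divides (line y ^+ m y) (line_subst x f)) ->
  (msize f <= \sum_(y <- s) m y)%N -> divides (line x) f.
Proof.
move=> us ds fs; apply: line_subst_eq0.
have [q qE] : divides (\prod_(y <- s) line y ^+ m y) (line_subst x f).
  apply: prime_elt_prod => // [y _|y z _ _]; [exact: line_prime|exact: line_distinct].
apply: contraTeq fs => r0; rewrite -ltnNge; apply: leq_trans (msize_line_subst x f).
have q0 : q != 0 by apply: contraNneq r0 => q0; rewrite qE q0 mul0r.
by rewrite qE msize_prod_line // -add1n leq_add2r lt0n msize_poly_eq0.
Qed.

Lemma lines_quotient s f : f != 0 -> uniq s ->
  (forall x, x \in s -> divides (line x) f) ->
  exists g, [/\ g != 0, f = \prod_(x <- s) line x * g &
                msize f = (msize g + size s)%N].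
Proof.
move=> f0 us ds; have [g fE] : divides (\prod_(x <- s) line x ^+ 1) f.
  apply: prime_elt_prod => // [y _|y z _ _]; [exact: line_prime|exact: line_distinct].
have g0 : g != 0 by apply: contraNneq f0 => g0; rewrite fE g0 mul0r.
exists g; split=> //; first by rewrite fE mulrC; congr (_ * _); apply: eq_bigr.
by rewrite {1}fE msize_prod_line // sum1_size.
Qed.

(* The substitution [X_a := p_a lambda + t X_a], as a polynomial in [t]: its order
   in [t] is the order of vanishing at [p].  The scale [lambda] (the variable
   ['X_ord_max]) is generic because [p] only matters up to a scalar; the constant
   term in [t] then vanishes exactly on the homogeneous prime of [p]. *)
Definition germ p : R -> {poly {mpoly F[4]}} :=
  mmap (polyC \o @mpolyC 4 F)
    (fun a => (p a *: 'X_ord_max)%:P + ('X_(lift ord_max a))%:P * 'X).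

HB.instance Definition _ p := GRing.RMorphism.copy (germ p)
  (mmap (polyC \o @mpolyC 4 F)
    (fun a => (p a *: 'X_ord_max)%:P + ('X_(lift ord_max a))%:P * 'X)).

Lemma germC p c : germ p c%:MP = c%:MP%:P.
Proof. exact: mmapC. Qed.

Lemma germX p a :
  germ p 'X_a = (p a *: 'X_ord_max)%:P + ('X_(lift ord_max a))%:P * 'X.
Proof. by rewrite /germ mmapX mmap1U. Qed.

Definition point_ideal p : set R := fun f => (germ p f).[0] = 0.

Definition vanish p m f : Prop := divides 'X^m (germ p f).

Lemma prime_polyX (B : idomainType) : prime_elt ('X : {poly B}).
Proof.
apply: (@kernel_prime _ _ (horner_eval (0 : B))); rewrite ?polyX_eq0 //.
  by rewrite /= /horner_eval hornerX.
move=> a; rewrite /= /horner_eval => /eqP/factor_theorem[q ->].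
by exists q; rewrite subr0.
Qed.

Lemma polyX_dvdP (B : idomainType) (a : {poly B}) : divides 'X a <-> a.[0] = 0.
Proof.
split=> [[q ->]|/eqP/factor_theorem[q ->]]; first by rewrite hornerMX mulr0.
by exists q; rewrite subr0.
Qed.

Lemma vanish0 p f : vanish p 0 f.
Proof. by exists (germ p f); rewrite mulr1. Qed.

Lemma vanish_anti p k l f : (k <= l)%N -> vanish p l f -> vanish p k f.
Proof.
by move=> kl [q fE]; exists (q * 'X^(l - k)); rewrite -mulrA -exprD subnK.
Qed.

(** The germ of [s] has nonzero constant term, hence is not divisible by the prime ['X]. *)
Lemma vanish_unit p m s f : ~ point_ideal p s -> vanish p m (s * f) -> vanish p m f.
Proof.
move=> ps; rewrite /vanish rmorphM; apply: prime_eltX; first exact: prime_polyX.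
by move/polyX_dvdP.
Qed.

Definition through p x := p x.1 == x.2 * p (nxt x.1).

Lemma germ_line p x : germ p (line x) =
  ((p x.1 - x.2 * p (nxt x.1)) *: 'X_ord_max)%:P +
  ('X_(lift ord_max x.1) - x.2 *: 'X_(lift ord_max (nxt x.1)))%:P * 'X.
Proof.
rewrite /line rmorphB -mul_mpolyC rmorphM /= germC !germX -!mul_mpolyC.
rewrite !rmorphB /= !rmorphM /=; ring.
Qed.

(** The germ of a line through [p] is ['X] times a nonzero constant, so it accounts for one order of
    vanishing; any other line accounts for none. *)
Lemma vanish_line p m x f :
  vanish p m (line x * f) -> vanish p (m - through p x) f.
Proof.
rewrite /through; case: eqP => [px|/eqP px]; last first.
  rewrite subn0; apply: vanish_unit; rewrite /point_ideal germ_line !hornerE.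
  apply/eqP; rewrite -mul_mpolyC mulf_neq0 //.
    by rewrite mpolyC_eq0 subr_eq0.
  apply/eqP => /(congr1 (meval (fun=> 1))).
  by rewrite mevalXU meval0; apply/eqP; rewrite oner_eq0.
case: m => [|m]; first by rewrite sub0n => _; apply: vanish0.
rewrite subn1 /= /vanish rmorphM /= germ_line px subrr scale0r polyC0 add0r.
have X0 : ('X : {poly {mpoly F[4]}}) != 0 by rewrite polyX_eq0.
case=> q; rewrite exprSr mulrA mulrAC => /(mulIf X0) qE.
(* One ['X] is cancelled; the remaining linear factor is constant in ['X] and nonzero. *)
apply: (@prime_eltX _ 'X _ ('X_(lift ord_max x.1) - x.2 *: 'X_(lift ord_max (nxt x.1)))%:P).
- exact: prime_polyX.
- move/polyX_dvdP; rewrite hornerC => /(congr1 (meval (fun a => (a == lift ord_max x.1)%:R))).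
  rewrite meval0 mevalB mevalZ !mevalXU eqxx (inj_eq lift_inj) nxt_neq mulr0 subr0.
  by apply/eqP; rewrite oner_eq0.
- by exists q.
Qed.

Lemma vanish_lines p m s f :
  vanish p m (\prod_(x <- s) line x * f) -> vanish p (m - count (through p) s) f.
Proof.
elim: s m => [|x s IHs] m; first by rewrite big_nil mul1r subn0.
by rewrite big_cons -mulrA /= subnDA => /vanish_line/IHs.
Qed.

(** If the line is parametrized as p Y + v T, restriction to it factors through the germ at [p]: the
    scale goes to Y, the variables to the constants v_a, and ['X] to T. *)
Lemma vanish_line_subst p m x f (Y T : R) (v : 'I_3 -> F) :
  (forall a, line_subst x 'X_a = p a *: Y + v a *: T) -> vanish p m f ->
  divides (T ^+ m) (line_subst x f).
Proof.
pose u b := if unlift ord_max b is Some a then (v a)%:MP else Y.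
pose th := [the {rmorphism _ -> _} of mmap (@mpolyC 3 F) u].
pose Th := [the {rmorphism _ -> _} of horner_eval T \o map_poly th].
move=> rX [q qE]; have -> : line_subst x f = Th (germ p f).
  apply: (@mmorph_ext _ _ _ (line_subst x) [the {rmorphism _ -> _} of Th \o germ p]) => [c|a].
    by rewrite /= line_substC germC map_polyC /= /horner_eval hornerC mmapC.
  rewrite /= rX germX rmorphD rmorphM /= !map_polyC /= map_polyX /horner_eval.
  by rewrite !hornerE mmapZ !mmapX !mmap1U /u unlift_none liftK !mul_mpolyC.
exists (Th q); rewrite qE rmorphM rmorphXn /=; congr (_ * _ ^+ _).
by rewrite map_polyX /horner_eval hornerX.
Qed.

End Lines.

(** * Lower bounds *)

Section LowerBounds.
Variable F : fieldType.
Local Notation R := {mpoly F[3]}.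
Implicit Types (f g : R) (p : 'I_3 -> F).

Definition coord_pt (j : 'I_3) : 'I_3 -> F := fun a => (a == j)%:R.

Definition vanish_fermat (n a b : nat) f : Prop :=
  (forall p, (forall c, p c ^+ n = 1) -> vanish p a f) /\
  (forall j, vanish (coord_pt j) b f).

Variables (n : nat) (mu : seq F).
Hypotheses (n_gt0 : (0 < n)%N) (mu_uniq : uniq mu) (mu_size : size mu = n).
Hypothesis mu_root : forall c, c \in mu -> c ^+ n = 1.

Let root_neq0 (c : F) : c ^+ n = 1 -> c != 0.
Proof.
by move=> c1; apply: contra_eq_neq c1 => ->; rewrite expr0n gtn_eqF // eq_sym oner_neq0.
Qed.

Lemma line_dvd_fermat a b f j c : c ^+ n = 1 -> vanish_fermat n a b f ->
  (msize f <= n * a + b)%N -> divides (line (j, c)) f.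
Proof.
move=> c1 [fmu fco] fs; pose k := nxt j; pose i := nxt k.
(* On the line X_j = c X_k, the equation X_k = t X_i cuts out the coordinate point for t = 0 and one
   root-of-unity point for each t in [mu]. *)
pose s : seq ('I_3 * F) := [seq (k, t) | t <- 0 :: mu].
have mu0 : 0 \notin mu by apply/negP => /mu_root/root_neq0; rewrite eqxx.
apply: (@line_dvd_of_subst _ _ s (fun y => if y.2 == 0 then b else a)).
- by rewrite map_inj_uniq /= ?mu0 // => u v [].
- pose v (l : 'I_3) := if l == j then c else if l == k then 1 else 0.
  move=> _ /mapP[t tmu ->] /=; case: eqP => [->|/eqP t0].
    apply: (@vanish_line_subst _ (coord_pt i) _ _ _ 'X_i _ v) => [l|]; last exact: fco.
    rewrite line_substX /line /coord_pt /v /i /k /=.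
    have [->|->|->] := nxtP j l; rewrite ?nxtE ?scale0r ?scale1r ?subr0 ?add0r ?addr0 //.
  move: tmu; rewrite in_cons (negbTE t0) /= => /mu_root t1.
  (* The point is (c t, t, 1) in the order j, k, i, and the direction [v] is (c, 1, 0). *)
  apply: (@vanish_line_subst _ (fun l => if l == j then c * t else if l == k then t else 1)
    _ _ _ 'X_i _ v) => [l|]; last first.
    apply: fmu => l; do 2?case: ifP => _; rewrite ?exprMn ?c1 ?t1 ?mulr1 ?expr1n //.
  rewrite line_substX /line /v /i /k /=.
  have [->|->|->] := nxtP j l; rewrite ?nxtE ?scale0r ?scale1r ?subr0 ?add0r ?addr0 //.
    by rewrite scalerBr scalerA addrC subrK.
  by rewrite addrC subrK.
rewrite big_map big_cons eqxx big_seq (eq_bigr (fun=> a)); last first.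
  by move=> t /mu_root/root_neq0/negbTE ->.
by rewrite -big_seq big_const_seq count_predT mu_size iter_addn_0 mulnC addnC.
Qed.

Lemma line_dvd_coord b f j : (forall i, vanish (coord_pt i) b f) ->
  (msize f <= 2 * b)%N -> divides (line (j, 0)) f.
Proof.
move=> fco fs; pose k := nxt j; pose i := nxt k.
(* The coordinate line contains two coordinate points, cut out by X_k = 0 and X_i = 0. *)
apply: (@line_dvd_of_subst _ _ [:: (k, 0); (i, 0)] (fun=> b)).
- by rewrite /= inE xpair_eqE neq_nxt.
- move=> y; rewrite !inE => /orP[]/eqP ->.
    apply: (@vanish_line_subst _ (coord_pt i) _ _ _ 'X_i _ (coord_pt k)) => [l|]; last exact: fco.
    rewrite line_substX /line /coord_pt /i /k /=.
    by have [->|->|->] := nxtP j l; rewrite ?nxtE ?scale0r ?scale1r ?subr0 ?add0r ?addr0.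
  apply: (@vanish_line_subst _ (coord_pt k) _ _ _ 'X_k _ (coord_pt i)) => [l|]; last exact: fco.
  rewrite line_substX /line /coord_pt /i /k /=.
  by have [->|->|->] := nxtP j l; rewrite ?nxtE ?scale0r ?scale1r ?subr0 ?add0r ?addr0.
by rewrite !big_cons big_nil addn0 addnn -mul2n.
Qed.

Definition pencil j : seq ('I_3 * F) := [seq (j, c) | c <- mu].

Lemma pencil_uniq j : uniq (pencil j).
Proof. by rewrite map_inj_uniq // => u v []. Qed.

(** The coefficient of a line through [p] can only be the ratio of the two coordinates. *)
Lemma count_pencil p j : (forall c, p c ^+ n = 1) -> (count (through p) (pencil j) <= 1)%N.
Proof.
move=> p1; rewrite count_map (eq_count (a2 := pred1 (p j / p (nxt j)))).
  by rewrite count_uniq_mem // leq_b1.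
move=> c /=; rewrite /through /=.
have pk0 := root_neq0 (p1 (nxt j)).
by rewrite [RHS]eq_sym (can2_eq (divfK pk0) (mulfK pk0)).
Qed.

Lemma vanish_fermat_pencil a f j :
  vanish_fermat n a 0 (\prod_(x <- pencil j) line x * f) -> vanish_fermat n (a - 1) 0 f.
Proof.
case=> fmu _; split=> [p p1|i]; last exact: vanish0.
by apply: vanish_anti (vanish_lines (fmu p p1)); rewrite leq_sub2l ?count_pencil.
Qed.

Lemma pencil_bound a f : f != 0 -> vanish_fermat n a 0 f -> (n * a < msize f)%N.
Proof.
elim: a f => [|a IHa] f f0 fv; first by rewrite muln0 lt0n msize_poly_eq0.
rewrite ltnNge; apply/negP => fs.
have [|g [g0 fE sE]] := lines_quotient f0 (pencil_uniq ord0).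
  by move=> _ /mapP[c /mu_root c1 ->]; apply: line_dvd_fermat fv _; rewrite // addn0.
have := IHa g g0; rewrite fE in fv; have := vanish_fermat_pencil fv.
rewrite subn1 /= => gv /(_ gv); move: fs; rewrite sE size_map mu_size mulnS addnC.
by rewrite leq_add2l ltnNge => ->.
Qed.

Definition fermat_lines : seq ('I_3 * F) :=
  pencil ord0 ++ pencil (nxt ord0) ++ pencil (nxt (nxt ord0)).

Lemma size_fermat_lines : size fermat_lines = (3 * n)%N.
Proof. by rewrite !size_cat !size_map mu_size; lia. Qed.

Lemma fermat_lines_uniq : uniq fermat_lines.
Proof.
have dis i j : i != j -> has (mem (pencil i)) (pencil j) = false.
  move=> ij; apply/hasPn => _ /mapP[c _ ->]; apply/mapP => -[d _ [ji _]].
  by rewrite ji eqxx in ij.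
by rewrite !cat_uniq !pencil_uniq has_cat !dis ?nxtE.
Qed.

Lemma count_fermat_lines p : (forall c, p c ^+ n = 1) -> (count (through p) fermat_lines <= 3)%N.
Proof.
move=> p1; rewrite !count_cat -[3%N]/(1 + (1 + 1))%N.
by do 2?apply: leq_add; apply: count_pencil.
Qed.

(** Exactly the pencil of index [nxt i] passes through the point, because both of its variables
    vanish there. *)
Lemma count_fermat_lines_coord i : count (through (coord_pt i)) fermat_lines = n.
Proof.
have c0 c : c \in mu -> c != 0 by move/mu_root/root_neq0.
have no j : (forall c, c \in mu -> ~~ through (coord_pt i) (j, c)) ->
    count (through (coord_pt i)) (pencil j) = 0%N.
  move=> h; apply/eqP; rewrite -leqn0 leqNgt -has_count; apply/hasPn => x.
  by case/mapP=> c /h ? ->.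
have pi : count (through (coord_pt i)) (pencil i) = 0%N.
  by apply: no => c _; rewrite /through /coord_pt /= !nxtE mulr0 oner_eq0.
have pnni : count (through (coord_pt i)) (pencil (nxt (nxt i))) = 0%N.
  by apply: no => c /c0 ?; rewrite /through /coord_pt /= !nxtE mulr1 eq_sym.
have pni : count (through (coord_pt i)) (pencil (nxt i)) = n.
  apply/eqP; rewrite -mu_size -(size_map (pair (nxt i))) -all_count.
  by apply/allP => x /mapP[c _ ->]; rewrite /through /coord_pt /= !nxtE mulr0.
rewrite !count_cat; have [iE|iE|iE] := nxtP ord0 i; rewrite iE ?nxt3 in pi pni pnni *;
  by rewrite pi pni pnni; lia.
Qed.

(** The subtractions are truncated, so the reduction also applies when a multiplicity is already
    below 3 or [n]. *)
Lemma fermat_reduction a b f : f != 0 -> vanish_fermat n a b f ->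
  (msize f <= n * a + b)%N ->
  exists g, [/\ g != 0, vanish_fermat n (a - 3) (b - n) g & msize f = (msize g + 3 * n)%N].
Proof.
move=> f0 fv fs; have [x|g [g0 fE sE]] := lines_quotient f0 fermat_lines_uniq.
  have lP j c : c \in mu -> divides (line (j, c)) f.
    by move=> /mu_root c1; apply: line_dvd_fermat fv fs.
  by rewrite !mem_cat => /or3P[]/mapP[c cmu ->]; apply: lP.
exists g; split; rewrite ?sE ?size_fermat_lines //.
rewrite fE in fv; case: fv => fmu fco; split=> [p p1|j].
  by apply: vanish_anti (vanish_lines (fmu p p1)); rewrite leq_sub2l ?count_fermat_lines.
by have := vanish_lines (fco j); rewrite count_fermat_lines_coord.
Qed.

(** Each coordinate point lies on two of the three coordinate lines, and the root-of-unity points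
    lie on none. *)
Lemma coord_reduction a b f : f != 0 -> vanish_fermat n a b f ->
  (msize f <= 2 * b)%N ->
  exists g, [/\ g != 0, vanish_fermat n a (b - 2) g & msize f = (msize g + 3)%N].
Proof.
move=> f0 fv fs.
pose s : seq ('I_3 * F) := [:: (ord0, 0); (nxt ord0, 0); (nxt (nxt ord0), 0)].
have su : uniq s by rewrite /s !cons_uniq !inE !xpair_eqE.
have [x|g [g0 fE sE]] := lines_quotient f0 su.
  rewrite !inE => /or3P[]/eqP ->; apply: line_dvd_coord fs; exact: fv.2.
exists g; split=> //; rewrite fE in fv; case: fv => fmu fco; split=> [p p1|j].
  have := vanish_lines (fmu p p1); rewrite /= /through /= !mul0r.
  by rewrite !(negbTE (root_neq0 (p1 _))) subn0.
apply: vanish_anti (vanish_lines (fco j)); rewrite leq_sub2l //.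
rewrite /= /through /coord_pt /= !mul0r.
by have [->|->|->] := nxtP ord0 j; rewrite ?nxtE ?eqxx ?oner_eq0.
Qed.

(* If both cases fail, then [2a+b <= d] and [2b <= d], whence [2a+3b <= 2d]. *)
Lemma fermat2_bound a b f : n = 2%N -> f != 0 -> vanish_fermat n a b f ->
  (2 * a + 3 * b <= 2 * (msize f).-1)%N.
Proof.
move=> n2; elim: {f}(msize f).+1 {-2}f (ltnSn (msize f)) a b => // d IHd f fd a b f0 fv.
have f_gt0 : (0 < msize f)%N by rewrite lt0n msize_poly_eq0.
have [le1|gt1] := leqP (msize f) (n * a + b)%N.
  have [g [g0 gv fE]] := fermat_reduction f0 fv le1.
  have g_gt0 : (0 < msize g)%N by rewrite lt0n msize_poly_eq0.
  (* Here 2a+3b drops by at most 12, twice the 6 lines removed; in the coordinate case below it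
     drops by at most 6, twice the 3 lines. *)
  have := IHd g _ _ _ g0 gv; rewrite fE n2 in fd *; lia.
have [le2|gt2] := leqP (msize f) (2 * b)%N.
  have [g [g0 gv fE]] := coord_reduction f0 fv le2.
  have g_gt0 : (0 < msize g)%N by rewrite lt0n msize_poly_eq0.
  have := IHd g _ _ _ g0 gv; rewrite fE in fd *; lia.
by rewrite n2 in gt1; lia.
Qed.

(** Each reduction lowers both multiplicities by 3 and the degree by 9. At multiplicity r a degree
    below 4r would force 9 lines to divide a form of degree less than 8. *)
Lemma fermat3_bound r k f : n = 3%N -> (0 < r <= 2)%N -> f != 0 ->
  vanish_fermat n (3 * k + r) (3 * k + r) f -> (9 * k + 4 * r < msize f)%N.
Proof.
move=> n3 r12; elim: k f => [|k IHk] f f0 fv; rewrite ltnNge; apply/negP => fs.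
  have [|g [g0 _ fE]] := fermat_reduction f0 fv; rewrite ?n3 in fs *; first lia.
  by rewrite fE n3 in fs; lia.
have [|g [g0 gv fE]] := fermat_reduction f0 fv; rewrite ?n3 in fs *; first lia.
have kE : (3 * k.+1 + r - 3 = 3 * k + r)%N by lia.
have kn : (3 * k.+1 + r - n = 3 * k + r)%N by rewrite n3.
rewrite kE kn in gv; have := IHk g g0 gv; rewrite fE n3 in fs; lia.
Qed.

(** From degree at most 20, one reduction leads to degree at most 8 with multiplicities 2 and 1. As
    8 < 4*2 + 1, twelve more lines would divide the quotient. *)
Lemma fermat4_bound f : n = 4%N -> f != 0 -> vanish_fermat n 5 5 f -> (21 < msize f)%N.
Proof.
move=> n4 f0 fv; rewrite ltnNge; apply/negP => fs.
have [|g [g0 gv fE]] := fermat_reduction f0 fv; rewrite ?n4 in fs *; first lia.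
have [|h [h0 hv gE]] := fermat_reduction g0 gv; rewrite ?n4 in fE *; first lia.
by rewrite fE gE n4 in fs; lia.
Qed.

(** In smaller degree 3n lines would divide [f], but 3n is at least 2n+2. *)
Lemma fermat_bound2 f : (2 <= n)%N -> f != 0 -> vanish_fermat n 2 2 f ->
  (2 * (n + 1) < msize f)%N.
Proof.
move=> n2 f0 fv; rewrite ltnNge; apply/negP => fs.
have [|g [g0 gv fE]] := fermat_reduction f0 fv; first lia.
have : (0 < msize g)%N by rewrite lt0n msize_poly_eq0.
by rewrite fE in fs; lia.
Qed.

End LowerBounds.

(** * The points of the Fermat ideal *)

Section FermatIdeal.
Variables (F : fieldType) (n : nat).
Hypotheses (n_gt1 : (1 < n)%N) (n_neq0 : n%:R != 0 :> F).
Local Notation R := {mpoly F[3]}.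
Local Notation I := (fermat_ideal F n).
Implicit Types (f g h : R) (p : 'I_3 -> F).

Let n_gt0 : (0 < n)%N := ltnW n_gt1.

(** A form of degree [n] in the two other variables, hence of multiplicity [n] at the coordinate
    point of index [j]. *)
Definition diff_pow (j : 'I_3) : R := 'X_(nxt j) ^+ n - 'X_(nxt (nxt j)) ^+ n.

Lemma nxt_ord : [/\ nxt ord0 = Ordinal (isT : 1 < 3)%N,
  nxt (nxt ord0) = Ordinal (isT : 2 < 3)%N & (ord0 : 'I_3) = Ordinal (isT : 0 < 3)%N].
Proof. by split; apply/val_inj. Qed.

Lemma fermat_gen j : I ('X_j * diff_pow j).
Proof.
apply: sub_ideal_gen => /=; rewrite !inE /diff_pow; have [<- <- <-] := nxt_ord.
apply/or3P; have [->|->|->] := nxtP ord0 j; rewrite ?nxt3.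
- by constructor 1.
- by constructor 2.
- by constructor 3.
Qed.

Lemma fermat_ideal_ideal : is_ideal I.
Proof. exact: ideal_gen_ideal. Qed.

Lemma fermat_ideal_min (K : set R) : is_ideal K ->
  (forall j, K ('X_j * diff_pow j)) -> forall f, I f -> K f.
Proof.
move=> idK Kg; apply: ideal_gen_min => // f /=; rewrite !inE.
have [e1 e2 e0] := nxt_ord; rewrite -e0 -e1 -e2.
case/or3P=> /eqP ->; first exact: (Kg ord0).
  by have := Kg (nxt ord0); rewrite /diff_pow nxt3.
by have := Kg (nxt (nxt ord0)); rewrite /diff_pow !nxt3.
Qed.

Lemma prime_ideal_X (A : idomainType) (P : set A) (a : A) k :
  prime_ideal P -> P (a ^+ k) -> P a.
Proof.
case/prime_idealP=> _ P1 PP; elim: k => [/P1//|k IHk].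
by rewrite exprS => /PP[].
Qed.

Lemma preim_ideal (A B : idomainType) (phi : {rmorphism A -> B}) (K : set B) :
  is_ideal K -> is_ideal (fun a => K (phi a)).
Proof.
case=> K0 KD KM; split=> [|a b Ka Kb|a b Kb]; first by rewrite rmorph0.
  by rewrite rmorphD; apply: KD.
by rewrite rmorphM; apply: KM.
Qed.

Lemma kernel_prime_ideal (A B : idomainType) (phi : {rmorphism A -> B}) :
  prime_ideal (fun a => phi a = 0).
Proof.
apply/prime_idealP; split=> [||a b].
- split=> [|a b a0 b0|a b b0]; first exact: rmorph0.
    by rewrite rmorphD a0 b0 addr0.
  by rewrite rmorphM b0 mulr0.
- by rewrite rmorph1; apply/eqP; rewrite oner_eq0.
- by rewrite rmorphM => /eqP; rewrite mulf_eq0 => /orP[]/eqP; [left|right].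
Qed.

(** * The homogeneous prime of a point *)

Section PointIdeal.
Variable p : 'I_3 -> F.

Lemma point_ideal_prime : prime_ideal (point_ideal p).
Proof.
exact: (kernel_prime_ideal
  [the {rmorphism _ -> _} of horner_eval (0 : {mpoly F[4]}) \o germ p]).
Qed.

Lemma point_idealX a : (germ p 'X_a).[0] = p a *: 'X_ord_max.
Proof. by rewrite germX !hornerE. Qed.

Lemma point_ideal_eval f : point_ideal p f -> f.@[p] = 0.
Proof.
move=> pf; pose th := [the {rmorphism _ -> _} of meval (fun _ : 'I_4 => 1 : F)].
pose ev := [the {rmorphism _ -> _} of horner_eval (0 : {mpoly F[4]})].
have -> : f.@[p] = th (germ p f).[0]; last by rewrite pf rmorph0.
apply: (@mmorph_ext _ _ _ (meval p) [the {rmorphism _ -> _} of th \o (ev \o germ p)]) => [c|a].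
  by rewrite /= mevalC germC /horner_eval hornerC mevalC.
by rewrite /= mevalXU /horner_eval point_idealX mevalZ mevalXU mulr1.
Qed.

(** Modulo [K], [f] equals the constant term of its germ with the scale replaced by [Y], and that
    term is zero. *)
Lemma point_ideal_congr (K : set R) (Y : R) f : is_ideal K ->
  (forall a, K ('X_a - p a *: Y)) -> point_ideal p f -> K f.
Proof.
move=> idK KX pf.
pose th := [the {rmorphism _ -> _} of mmap (@mpolyC 3 F) (fun _ : 'I_4 => Y)].
pose ev := [the {rmorphism _ -> _} of horner_eval (0 : {mpoly F[4]})].
have -> : f = f - th (germ p f).[0] by rewrite pf rmorph0 subr0.
apply: (@mmorph_congr _ _ _ idfun [the {rmorphism _ -> _} of th \o (ev \o germ p)] K)
  => // [c|a].
  by rewrite /= germC /horner_eval hornerC mmapC.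
by rewrite /= /horner_eval point_idealX mmapZ mmapX mmap1U mul_mpolyC.
Qed.

Hypothesis I_point : forall j, p j * (p (nxt j) ^+ n - p (nxt (nxt j)) ^+ n) = 0.

Lemma fermat_sub_point f : I f -> point_ideal p f.
Proof.
apply: fermat_ideal_min f => [|j].
  by case/prime_idealP: point_ideal_prime.
pose ev := [the {rmorphism _ -> _} of horner_eval (0 : {mpoly F[4]}) \o germ p].
have evX a : ev 'X_a = (p a)%:MP * 'X_ord_max.
  by rewrite /= /horner_eval point_idealX mul_mpolyC.
rewrite -[point_ideal _ _]/(ev _ = 0) /diff_pow rmorphM rmorphB !rmorphXn !evX.
rewrite !exprMn -mulrBl mulrACA.
by rewrite -!rmorphXn -rmorphB -rmorphM I_point rmorph0 mul0r.
Qed.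

(** The prime is the annihilator of the class of [h]: the forms X_a - p_a Y generate enough of it to
    kill [h], and conversely [h] is nonzero at [p], so a product with [h] in the prime forces the
    other factor into it. *)
Lemma point_associated h (Y : R) : h.@[p] != 0 ->
  (forall a, I (('X_a - p a *: Y) * h)) -> Ass I (point_ideal p).
Proof.
move=> hp Ih; split; first exact: point_ideal_prime.
exists h; apply/seteqP; split=> f; last first.
  have /prime_idealP[_ _ PP] := point_ideal_prime.
  move=> Ifh; have [pf|ph] := PP _ _ (fermat_sub_point Ifh); first exact: pf.
  by case/eqP: hp; apply: point_ideal_eval ph.
apply: (@point_ideal_congr (fun q => I (q * h)) Y f) => //.
case: fermat_ideal_ideal => I0 ID IM; split=> [|a b Ia Ib|a b Ib].
- by rewrite mul0r.
- by rewrite mulrDl; apply: ID.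
- by rewrite -mulrA; apply: IM.
Qed.

(** Germs of elements of [I] are divisible by ['X], so products of [m] of them are divisible by its
    [m]-th power. *)
Lemma local_pow_vanish m f : local_pow (point_ideal p) I m f -> vanish p m f.
Proof.
case=> s [ps sf]; apply: vanish_unit ps _; move: (s * f) sf.
apply: ideal_gen_min.
  exact: (preim_ideal [the {rmorphism _ -> _} of germ p] (divides_ideal 'X^m)).
move=> _ [g [Ig ->]]; rewrite /vanish rmorph_prod.
have /boolp.choice[q qE] : forall i, divides 'X (germ p (g i)).
  by move=> i; apply/polyX_dvdP; apply: fermat_sub_point (Ig i).
exists (\prod_(i < m) q i); rewrite (eq_bigr (fun i => q i * 'X)) => [|i _]; last exact: qE.
by rewrite big_split /= prodr_const card_ord.
Qed.

End PointIdeal.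

Lemma coord_pt_zero i j : let p := @coord_pt F i in
  p j * (p (nxt j) ^+ n - p (nxt (nxt j)) ^+ n) = 0.
Proof.
rewrite /coord_pt /=; have [->|->|->] := nxtP i j;
  by rewrite !nxtE ?mul0r // expr0n gtn_eqF // subrr mulr0.
Qed.

Lemma coord_associated i : Ass I (point_ideal (@coord_pt F i)).
Proof.
pose j := nxt i; pose k := nxt j.
(* The witness is the product of D_j and D_k up to sign: X_j and X_k multiply it into the ideal. *)
apply: (@point_associated _ (@coord_pt_zero i)
  (('X_j ^+ n - 'X_i ^+ n) * ('X_k ^+ n - 'X_i ^+ n)) 'X_i).
  rewrite mevalM !mevalB !rmorphXn /= !mevalXU /coord_pt /k /j !nxtE.
  by rewrite expr0n expr1n gtn_eqF // sub0r mulrNN mulr1 oner_neq0.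
move=> a; case: fermat_ideal_ideal => I0 ID IM; rewrite /coord_pt.
have [->|->|->] := nxtP i a; rewrite !nxtE ?scale0r ?scale1r ?subrr ?subr0 ?mul0r //.
  by rewrite mulrCA; apply: IM; have := fermat_gen j; rewrite /diff_pow nxt3.
have -> : 'X_k * (('X_j ^+ n - 'X_i ^+ n) * ('X_k ^+ n - 'X_i ^+ n)) =
    - ('X_k ^+ n - 'X_i ^+ n) * ('X_k * ('X_i ^+ n - 'X_j ^+ n)) :> R by ring.
by apply: IM; have := fermat_gen k; rewrite /diff_pow /k /j !nxt3.
Qed.

Lemma root_associated p : (forall a, p a ^+ n = 1) -> Ass I (point_ideal p).
Proof.
move=> p1; have p0 a : p a != 0.
  by apply: contra_eq_neq (p1 a) => ->; rewrite expr0n gtn_eqF // eq_sym oner_neq0.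
pose i : 'I_3 := ord0; pose j := nxt i; pose k := nxt j.
(* This scale makes the [n]-th power of p_a Y equal to that of X_i. Then [E a] completes X_a - p_a Y
   to a difference of [n]-th powers, and its value at [p] is n p_a^(n-1). *)
pose Y : R := (p i)^-1 *: 'X_i.
pose E a : R := \sum_(l < n) 'X_a ^+ (n.-1 - l) * (p a *: Y) ^+ l.
have EP a : ('X_a - p a *: Y) * E a = 'X_a ^+ n - 'X_i ^+ n.
  rewrite -subrXX; congr (_ - _).
  by rewrite scalerA exprZn exprMn exprVn !p1 invr1 mulr1 scale1r.
(* [E j] produces D_k up to sign and [E k] produces D_j; the variables turn these into
   generators. *)
apply: (@point_associated p _ ('X_i * 'X_j * 'X_k * E j * E k) Y) => [a||a].
- by rewrite !p1 subrr mulr0.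
- have Ep a : (E a).@[p] != 0.
    rewrite /E raddf_sum /= (eq_bigr (fun=> p a ^+ n.-1)) => [|l _].
      by rewrite sumr_const card_ord -mulr_natr mulf_neq0 ?expf_neq0.
    rewrite mevalM !rmorphXn /= !mevalZ !mevalXU mulVf // mulr1 -exprD subnK //.
    by rewrite -ltnS prednK.
  by rewrite !mevalM !mevalXU !mulf_neq0.
case: fermat_ideal_ideal => I0 ID IM.
have [->|->|->] := nxtP i a.
- by rewrite /Y scalerA divff // scale1r subrr mul0r.
- have -> : ('X_(nxt i) - p (nxt i) *: Y) * ('X_i * 'X_j * 'X_k * E j * E k) =
      - ('X_i * 'X_j * E k) * ('X_k * - (('X_j - p j *: Y) * E j)).
    by rewrite -/j; ring.
  by apply: IM; have := fermat_gen k; rewrite /diff_pow /k /j !nxt3 EP opprB.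
have -> : ('X_(nxt (nxt i)) - p (nxt (nxt i)) *: Y) * ('X_i * 'X_j * 'X_k * E j * E k) =
    ('X_i * 'X_k * E j) * ('X_j * (('X_k - p k *: Y) * E k)).
  by rewrite -/j -/k; ring.
by apply: IM; have := fermat_gen j; rewrite /diff_pow /k /j !nxt3 EP.
Qed.

Lemma symbolic_vanish m f : symbolic_pow I m f -> vanish_fermat n m m f.
Proof.
move/symbolic_powP=> If; split=> [p p1|j].
  apply: local_pow_vanish => [j|]; first by rewrite !p1 subrr mulr0.
  exact: If (root_associated p1).
by apply: local_pow_vanish (If _ (coord_associated j)); apply: coord_pt_zero.
Qed.

End FermatIdeal.

(** * Members of the symbolic powers *)

Section SymbolicMembers.
Variables (F : fieldType) (n : nat).
Hypothesis n_gt1 : (1 < n)%N.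
Local Notation R := {mpoly F[3]}.
Local Notation I := (fermat_ideal F n).
Local Notation D := (diff_pow F n).
Implicit Types (f g h : R) (j : 'I_3).

Let n_gt0 : (0 < n)%N := ltnW n_gt1.

Lemma line_coord j : line (j, 0) = 'X_j :> R.
Proof. by rewrite /line scale0r subr0. Qed.

Lemma diff_pow_sum j : D j + D (nxt j) + D (nxt (nxt j)) = 0.
Proof. by rewrite /diff_pow !nxt3; ring. Qed.

Lemma fermatP f : I f -> exists a : 'I_3 -> R, f = \sum_j a j * ('X_j * D j).
Proof.
apply: (@fermat_ideal_min _ _
  (fun f => exists a : 'I_3 -> R, f = \sum_j a j * ('X_j * D j))) f => [|j].
  split=> [|f g [a ->] [b ->]|c f [a ->]].
  - by exists (fun=> 0); rewrite big1 // => j _; rewrite mul0r.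
  - exists (fun j => a j + b j); rewrite -big_split; apply: eq_bigr => j _.
    by rewrite mulrDl.
  - exists (fun j => c * a j); rewrite mulr_sumr; apply: eq_bigr => j _.
    exact: mulrA.
exists (fun i => (i == j)%:R); rewrite (bigD1 j) //= eqxx mul1r big1 ?addr0 //.
by move=> i /negbTE ->; rewrite mul0r.
Qed.

Lemma sum_nxt (V : nmodType) (a : 'I_3 -> V) j :
  \sum_i a i = a j + a (nxt j) + a (nxt (nxt j)).
Proof.
rewrite (bigD1 j) // (bigD1 (nxt j)) ?nxtE // (bigD1 (nxt (nxt j))) ?nxtE //=.
rewrite big1 ?addr0 ?addrA // => i; have [->|->|->] := nxtP j i; by rewrite !eqxx ?andbF.
Qed.

Lemma line_subst_coord j : line_subst (j, 0) ('X_j : R) = 0.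
Proof. by rewrite line_substX eqxx scale0r. Qed.

Lemma mulX_eq0 (A : idomainType) (x y a b : A) m :
  x != 0 -> y != 0 -> a * (x * y ^+ m.+1) = b * (y * x ^+ m.+1) ->
  a * y ^+ m = b * x ^+ m.
Proof.
move=> x0 y0 ab; apply: (mulIf (mulf_neq0 x0 y0)).
have -> : a * y ^+ m * (x * y) = a * (x * y ^+ m.+1) by rewrite exprS; ring.
by rewrite ab exprS; ring.
Qed.

Lemma mpolyX_neq0 j : ('X_j : R) != 0.
Proof. by rewrite -line_coord line_neq0. Qed.

(** The relation of [colon_coord] read modulo [z], where the generator with factor [z]
    disappears. *)
Lemma relation_mod (A B : comNzRingType) (phi : {rmorphism A -> B}) (x y z a b c f : A) m :
  (0 < m)%N -> phi z = 0 ->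
  z * f = c * (z * (x ^+ m - y ^+ m)) + a * (x * (y ^+ m - z ^+ m)) +
          b * (y * (z ^+ m - x ^+ m)) ->
  phi a * (phi x * phi y ^+ m) = phi b * (phi y * phi x ^+ m).
Proof.
move=> m_gt0 z0 /(congr1 phi).
rewrite !(rmorphM, rmorphD, rmorphN, rmorphXn) z0 expr0n gtn_eqF // !mul0r mulr0.
by rewrite oppr0 addr0 !add0r !mulrN => /eqP; rewrite eq_sym subr_eq0 => /eqP.
Qed.

(** The terms in [e] collapse to -e z^(m+1) (x^(m+1) - y^(m+1)), so a factor [z] can be extracted
    from the whole right-hand side. *)
Lemma saturation_combination (A : comNzRingType) (x y z a' b' e c f : A) m :
  z * f = c * (z * (x ^+ m.+1 - y ^+ m.+1)) +
          (e * x ^+ m + a' * z) * (x * (y ^+ m.+1 - z ^+ m.+1)) +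
          (e * y ^+ m + b' * z) * (y * (z ^+ m.+1 - x ^+ m.+1)) ->
  f * z = (a' * (x * (y ^+ m.+1 - z ^+ m.+1)) + b' * (y * (z ^+ m.+1 - x ^+ m.+1)) +
          (c - e * z ^+ m) * (x ^+ m.+1 - y ^+ m.+1)) * z.
Proof. by rewrite [f * z]mulrC => ->; rewrite !exprS; ring. Qed.

(* Modulo [X_j], a relation [X_j f = \sum_l a_l X_l D_l] reads
   [a_k X_i^(n-1) = a_i X_k^(n-1)], and the two powers are coprime. *)
Lemma colon_coord j f : I ('X_j * f) -> exists c g, I g /\ f = g + c * D j.
Proof.
have [_ ID IM] := fermat_ideal_ideal F n.
case/fermatP=> a; rewrite (sum_nxt _ j); set k := nxt j; set i := nxt k.
have [m nE] : exists m, n = m.+1 by exists n.-1; rewrite prednK.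
have ji : (i != j) /\ (k != j) by rewrite /i /k !nxtE.
case: ji => ij kj.
have Dk : D k = 'X_i ^+ n - 'X_j ^+ n by rewrite /diff_pow /i /k nxt3.
have Di : D i = 'X_j ^+ n - 'X_k ^+ n by rewrite /diff_pow /i /k !nxt3.
have Dj : D j = 'X_k ^+ n - 'X_i ^+ n by rewrite /diff_pow.
rewrite Dk Di Dj => fE.
pose r := line_subst (j, (0 : F)).
have rE : r (a k) * ('X_k * 'X_i ^+ m.+1) = r (a i) * ('X_i * 'X_k ^+ m.+1).
  have := relation_mod n_gt0 (line_subst_coord j) fE.
  by rewrite /= !line_substX /= (negbTE ij) (negbTE kj) nE.
have {}rE := mulX_eq0 (mpolyX_neq0 k) (mpolyX_neq0 i) rE.
have [e akE] : divides ('X_k ^+ m) (r (a k)).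
  rewrite -line_coord; apply: (@prime_eltX _ _ _ ('X_i ^+ m)).
  - exact: line_prime.
  - apply: (@line_ndvd _ (fun l => (l == i)%:R)) => /=.
      by rewrite mul0r /i /k nxtE.
    by rewrite rmorphXn /= mevalXU eqxx expr1n oner_neq0.
  - by exists (r (a i)); rewrite line_coord mulrC.
have aiE : r (a i) = e * 'X_i ^+ m.
  apply: (mulIf (expf_neq0 m (mpolyX_neq0 k))).
  by rewrite -rE akE mulrAC.
have [a' ak'] := line_dvdB (j, 0) (a k); have [b' ai'] := line_dvdB (j, 0) (a i).
rewrite line_coord in ak' ai'.
have {ak'}ak' : a k = e * 'X_k ^+ m + a' * 'X_j by rewrite -akE -ak' addrC subrK.
have {ai'}ai' : a i = e * 'X_i ^+ m + b' * 'X_j by rewrite -aiE -ai' addrC subrK.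
exists (a j - e * 'X_j ^+ m), (a' * ('X_k * D k) + b' * ('X_i * D i)); split.
  by apply: ID; apply: IM; apply: fermat_gen.
apply: (mulIf (mpolyX_neq0 j)); rewrite Dk Di nE; apply: saturation_combination.
by rewrite ak' ai' nE in fE.
Qed.

Lemma point_ideal_coord j f : point_ideal (@coord_pt F j) f ->
  exists u v, f = u * 'X_(nxt j) + v * 'X_(nxt (nxt j)).
Proof.
move=> pf; apply: (@point_ideal_congr _ _
  (fun f => exists u v, f = u * 'X_(nxt j) + v * 'X_(nxt (nxt j))) 'X_j) pf.
  split=> [|g h [u [v ->]] [u' [v' ->]]|c g [u [v ->]]].
  - by exists 0, 0; rewrite !mul0r addr0.
  - by exists (u + u'), (v + v'); rewrite !mulrDl addrACA.
  - by exists (c * u), (c * v); rewrite mulrDr !mulrA.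
move=> a; rewrite /coord_pt; have [->|->|->] := nxtP j a; rewrite !nxtE.
- by exists 0, 0; rewrite scale1r subrr !mul0r addr0.
- by exists 1, 0; rewrite scale0r subr0 mul1r mul0r addr0.
- by exists 0, 1; rewrite scale0r subr0 mul1r mul0r add0r.
Qed.

Lemma point_ideal_coordX j a : a != j -> point_ideal (@coord_pt F j) 'X_a.
Proof.
by move=> /negbTE aj; rewrite /point_ideal point_idealX /coord_pt aj scale0r.
Qed.

(* Modulo [I], [f] is a multiple [c D_j]; the two other variables force [c] to
   vanish at the other two coordinate points, so that [c] lies in
   [(X_k X_i, X_j)], which multiplies [D_j] into [I]. *)
Lemma fermat_saturated f : (forall j, I ('X_j * f)) -> I f.
Proof.
move=> If; pose j : 'I_3 := ord0; pose k := nxt j; pose i := nxt k.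
have [_ ID IM] := fermat_ideal_ideal F n.
have [c [g [Ig fE]]] := colon_coord (If j).
have cP l : l != j -> point_ideal (@coord_pt F l) c.
  move=> lj; have /prime_idealP[_ _ PP] := point_ideal_prime (@coord_pt F l).
  have Ic : I ('X_l * c * D j).
    have -> : 'X_l * c * D j = 'X_l * f - 'X_l * g by rewrite fE; ring.
    by apply: idealB => //; [exact: fermat_ideal_ideal|exact: IM].
  have := fermat_sub_point (@coord_pt_zero F n n_gt1 l) Ic.
  case/PP=> [/PP[/point_ideal_eval|pc]|/point_ideal_eval].
  - by rewrite mevalXU /coord_pt eqxx => /eqP; rewrite oner_eq0.
  - exact: pc.
  rewrite mevalB !rmorphXn /= !mevalXU /coord_pt.
  have := nxtP j l; case=> lE; first by rewrite lE eqxx in lj.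
    rewrite lE !nxtE expr0n gtn_eqF // expr1n subr0 => /eqP.
    by rewrite oner_eq0.
  rewrite lE !nxtE expr0n gtn_eqF // expr1n sub0r => /eqP.
  by rewrite oppr_eq0 oner_eq0.
have [u [v cE]] : exists u v, c = u * 'X_i + v * 'X_j.
  exact: (point_ideal_coord (cP k isT)).
have pu : point_ideal (@coord_pt F i) u.
  have /prime_idealP[idP _ PP] := point_ideal_prime (@coord_pt F i).
  have ji : j != i by rewrite /i /k nxtE.
  have : point_ideal (@coord_pt F i) (u * 'X_i).
    have -> : u * 'X_i = c - v * 'X_j by rewrite cE addrK.
    apply: idealB => //; first by apply: cP; rewrite eq_sym.
    by case: idP => _ _; apply; apply: point_ideal_coordX.
  case/PP=> [pu|/point_ideal_eval]; first exact: pu.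
  by rewrite mevalXU /coord_pt eqxx => /eqP; rewrite oner_eq0.
have [u' [v' uE]] := point_ideal_coord pu.
rewrite fE; apply: (ID) => //.
(* The part v' X_k X_i D_j of the product becomes a combination of generators through D_j = -(D_k +
   D_i). *)
have -> : c * D j = (u' * 'X_i + v) * ('X_j * D j)
    + - (v' * 'X_i) * ('X_k * D k) + - (v' * 'X_k) * ('X_i * D i).
  have -> : D j = - (D k + D i).
    by apply/eqP; rewrite -addr_eq0 addrA; apply/eqP; exact: (diff_pow_sum j).
  by rewrite cE uE /i /k !nxt3; ring.
by apply: (ID); [apply: (ID)|]; apply: IM; apply: fermat_gen.
Qed.

(** * Associated primes of the Fermat ideal *)

Section AssociatedPrime.
Variable P : set R.
Hypothesis AP : Ass I P.

Lemma ass_prime : prime_ideal P.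
Proof. by case: AP. Qed.

Lemma fermat_sub_ass f : I f -> P f.
Proof.
case: AP => _ [h ->] If; rewrite /ann_quot /= mulrC.
by case: (fermat_ideal_ideal F n) => _ _; apply.
Qed.

(** If all variables killed the class of [h], saturation would put [h] in the ideal and 1 in [P]. *)
Lemma ass_neq_irrelevant : ~ forall j, P 'X_j.
Proof.
case: AP => /prime_idealP[_ P1 _] [h Ph] PX; apply: P1; rewrite Ph /ann_quot /= mul1r.
by apply: fermat_saturated => j; have := PX j; rewrite Ph.
Qed.

(** If X_a lies in [P], the generator X_k D_k puts X_k X_i^n in [P], hence a second variable; the
    third stays outside by [ass_neq_irrelevant]. *)
Lemma ass_cases : (forall j, ~ P 'X_j) \/
  exists j, [/\ ~ P 'X_j, P 'X_(nxt j) & P 'X_(nxt (nxt j))].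
Proof.
have /prime_idealP[[_ PD PM] P1 PP] := ass_prime.
have [[a Pa]|nP] := pselect (exists a, P 'X_a); last first.
  by left=> j Pj; apply: nP; exists j.
right; pose k := nxt a; pose i := nxt k.
have nall : ~ (P 'X_k /\ P 'X_i).
  by case=> Pk Pi; apply: ass_neq_irrelevant => j; have [->|->|->] := nxtP a j.
have : P ('X_k * 'X_i ^+ n).
  have -> : 'X_k * 'X_i ^+ n = 'X_k * D k + 'X_k * 'X_a ^+ n :> R.
    by rewrite /diff_pow /i /k nxt3; ring.
  apply: PD; first by apply: fermat_sub_ass; apply: fermat_gen.
  by apply: (PM); rewrite -(prednK n_gt0) exprSr; apply: PM.
case/PP=> [Pk|/(prime_ideal_X ass_prime) Pi].
  by exists i; rewrite /i /k nxt3; split=> // Pi; apply: nall.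
by exists k; rewrite /i /k nxt3; split=> // Pk; apply: nall.
Qed.

Lemma local_diff_pow k : ~ P 'X_k -> local_pow P I 1 (D k).
Proof. by exists 'X_k; split=> //; apply: ideal_pow_1; apply: fermat_gen. Qed.

Lemma diff_pow_notin j k : j != k -> ~ P 'X_j -> P 'X_k -> ~ P ('X_j ^+ n - 'X_k ^+ n).
Proof.
have /prime_idealP[[_ PD PM] P1 PP] := ass_prime.
move=> jk Pj Pk Pd; apply: Pj; apply: (prime_ideal_X (k := n) ass_prime).
rewrite -['X_j ^+ n](subrK ('X_k ^+ n)); apply: PD => //.
by rewrite -(prednK n_gt0) exprSr; apply: PM.
Qed.

Lemma diff_powN_notin j k : j != k -> ~ P 'X_j -> P 'X_k -> ~ P ('X_k ^+ n - 'X_j ^+ n).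
Proof.
have /prime_idealP[[_ PD PM] P1 PP] := ass_prime.
move=> jk Pj Pk Pd; apply: (diff_pow_notin jk Pj Pk).
by rewrite -opprB -mulN1r; apply: PM.
Qed.

Section Coordinate.
Variable j : 'I_3.
Hypotheses (Pj : ~ P 'X_j) (Pk : P 'X_(nxt j)) (Pi : P 'X_(nxt (nxt j))).
Local Notation k := (nxt j).
Local Notation i := (nxt (nxt j)).

Lemma coord_Dk : ~ P (D k).
Proof. by rewrite /diff_pow nxt3; apply: diff_powN_notin; rewrite ?nxtE. Qed.

Lemma coord_Di : ~ P (D i).
Proof. by rewrite /diff_pow !nxt3; apply: diff_pow_notin; rewrite ?nxtE. Qed.

(** D_k and D_i are units at [P], so the generators X_k D_k and X_i D_i put X_k and X_i into the
    localized ideal. *)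
Lemma local_var a : local_pow P I (a != j) 'X_a.
Proof.
have [->|->|->] := nxtP j a; rewrite ?nxtE.
- exact: local_pow_0 ass_prime _.
- exists (D k); split; first exact: coord_Dk.
  by rewrite mulrC; apply: ideal_pow_1; apply: fermat_gen.
exists (D i); split; first exact: coord_Di.
by rewrite mulrC; apply: ideal_pow_1; apply: fermat_gen.
Qed.

(** D_j is X_k^n - X_i^n, and both powers lie locally in the [n]-th power of the ideal, with
    denominators D_k^n and D_i^n. *)
Lemma local_diff_coord : local_pow P I n (D j).
Proof.
have /prime_idealP[_ P1 PP] := ass_prime.
have [_ ID IM] := ideal_pow_ideal I n.
exists (D k ^+ n * D i ^+ n); split.
  by case/PP=> /(prime_ideal_X ass_prime); [exact: coord_Dk|exact: coord_Di].
have -> : D k ^+ n * D i ^+ n * D j =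
    D i ^+ n * ('X_k * D k) ^+ n + - D k ^+ n * ('X_i * D i) ^+ n.
  by rewrite {3}/diff_pow !exprMn; ring.
by apply: ID; apply: IM; apply: ideal_powX; apply: fermat_gen.
Qed.

End Coordinate.
End AssociatedPrime.

Definition fermat_product (e d : 'I_3 -> nat) : R :=
  \prod_j ('X_j ^+ e j * D j ^+ d j).

Lemma local_pow_prod P (u v e d : 'I_3 -> nat) : prime_ideal P ->
  (forall j, local_pow P I (u j) 'X_j) -> (forall j, local_pow P I (v j) (D j)) ->
  local_pow P I (\sum_j (e j * u j + d j * v j)) (fermat_product e d).
Proof.
move=> pP Pu Pv; rewrite /fermat_product.
apply: (big_rec2 (fun k f => local_pow P I k f)) => [|j k f _ IHf].
  exact: local_pow_0.
by apply: local_powM => //; apply: local_powM => //; apply: local_powX.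
Qed.

(** The first bound serves the primes containing no variable, where every D_j has order at least
    one. The second serves the coordinate points, where two variables have order one and D_j has
    order [n]. *)
Lemma fermat_product_symbolic m e d :
  (m <= \sum_j d j)%N ->
  (forall j, m <= e (nxt j) + e (nxt (nxt j)) + n * d j)%N ->
  symbolic_pow I m (fermat_product e d).
Proof.
move=> dm em; apply/symbolic_powP => P AP.
have pP := ass_prime AP.
case: (ass_cases AP) => [nP|[j [Pj Pk Pi]]].
  apply: (local_pow_anti dm).
  rewrite (eq_bigr (fun j => e j * 0 + d j * 1)%N) => [|j _]; last by rewrite muln0 muln1.
  apply: (@local_pow_prod _ (fun=> 0%N) (fun=> 1%N)) => // j; first exact: local_pow_0.
  exact: local_diff_pow.
apply: (local_pow_anti (em j)).
have -> : (e (nxt j) + e (nxt (nxt j)) + n * d j =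
    \sum_a (e a * (a != j) + d a * (if a == j then n else 0)))%N.
  rewrite (sum_nxt _ j) !nxtE !muln0 !muln1 !addn0 add0n [(d j * n)%N]mulnC; lia.
apply: local_pow_prod => // a; first exact: local_var.
by case: eqP => [->|_]; [exact: local_diff_coord|exact: local_pow_0].
Qed.

Lemma diff_pow_homog j : D j \is n.-homog.
Proof.
have hX a : ('X_a ^+ n : R) \is n.-homog.
  have h1 : ('X_a : R) \is 1.-homog by rewrite dhomogX; apply/eqP; exact: mdeg1.
  by have := dhomogMn n h1; rewrite mul1n.
by apply: rpredB; apply: hX.
Qed.

Lemma diff_pow_neq0 j : D j != 0.
Proof.
apply/eqP => /(congr1 (meval (fun a => (a == nxt j)%:R))).
rewrite /diff_pow mevalB !rmorphXn /= !mevalXU meval0 !nxtE.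
by rewrite expr0n gtn_eqF // expr1n subr0 => /eqP; rewrite oner_eq0.
Qed.

Lemma fermat_product_homog e d :
  fermat_product e d \is (\sum_j (e j + n * d j)).-homog.
Proof.
apply: (big_rec2 (fun f k => f \is k.-homog)) => [|j k f _ IHf]; first exact: dhomog1.
apply: dhomogM => //; apply: dhomogM; last exact: dhomogMn (diff_pow_homog j).
have h1 : ('X_j : R) \is 1.-homog by rewrite dhomogX; apply/eqP; exact: mdeg1.
by have := dhomogMn (e j) h1; rewrite mul1n.
Qed.

Lemma fermat_product_neq0 e d : fermat_product e d != 0.
Proof.
by apply/prodf_neq0 => j _; rewrite mulf_neq0 ?expf_neq0 ?mpolyX_neq0 ?diff_pow_neq0.
Qed.

End SymbolicMembers.

(** * Initial degrees *)

Section InitialDegrees.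
Variable F : numClosedFieldType.
Local Notation I n := (fermat_ideal (F : fieldType) n).

Lemma unity_roots n : (0 < n)%N ->
  exists mu : seq F, [/\ uniq mu, size mu = n & forall c, c \in mu -> c ^+ n = 1].
Proof.
move=> n_gt0; have [mu muE] := closed_field_poly_normal ('X^n - 1 : {poly F}).
have lc1 : lead_coef ('X^n - 1 : {poly F}) = 1 by rewrite lead_coefXnsubC.
rewrite lc1 scale1r in muE; exists mu; split=> [||c cmu].
- rewrite -separable_prod_XsubC -muE separable_Xn_sub_1 //.
  by rewrite pnatr_eq0 -lt0n.
- by apply: succn_inj; rewrite -(size_prod_XsubC mu id) -muE size_XnsubC.
have : root ('X^n - 1) c by rewrite muE root_prod_XsubC.
by rewrite rootE !hornerE subr_eq0 => /eqP.
Qed.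

Definition triple (a b c : nat) : 'I_3 -> nat := fun j => nth 0%N [:: a; b; c] j.

Lemma fermat_initial_degree n m a b c a' b' c' d : (1 < n)%N ->
  (m <= a' + b' + c')%N ->
  [/\ m <= b + c + n * a', m <= c + a + n * b' & m <= a + b + n * c']%N ->
  (a + b + c + n * (a' + b' + c') = d)%N ->
  (forall f : {mpoly F[3]}, f != 0 -> vanish_fermat n m m f -> (d < msize f)%N) ->
  initial_degree (symbolic_pow (I n) m) d.
Proof.
move=> n_gt1 sm [ma mb mc] dE lower; split.
  exists (fermat_product F n (triple a b c) (triple a' b' c')); split.
  - apply: fermat_product_symbolic => // [|j].
      by rewrite !big_ord_recr big_ord0 /= add0n.
    by have [->|->|->] := nxtP ord0 j; rewrite ?nxt3.
  - exact: fermat_product_neq0.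
  - have := fermat_product_homog F n (triple a b c) (triple a' b' c').
    suff -> : (\sum_j (triple a b c j + n * triple a' b' c' j) = d)%N by [].
    by rewrite -dE !big_ord_recr big_ord0 /triple /= !mulnDr; lia.
move=> e f If f0 fe; rewrite -ltnS -(msize_dhomog f0 fe); apply: lower => //.
by apply: symbolic_vanish If; rewrite ?pnatr_eq0 -?lt0n // ltnW.
Qed.

Lemma mul_bound n m (f : {mpoly F[3]}) : (0 < n)%N -> f != 0 ->
  vanish_fermat n m m f -> (m * n < msize f)%N.
Proof.
move=> n_gt0 f0 [fmu _]; have [mu [mu_uniq mu_size mu_root]] := unity_roots n_gt0.
rewrite mulnC; apply: (pencil_bound n_gt0 mu_uniq mu_size mu_root f0).
by split=> // j; apply: vanish0.
Qed.

Lemma initial_degree_sym2 n : (1 < n)%N ->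
  initial_degree (symbolic_pow (I n) 2) (2 * (n + 1))%N.
Proof.
move=> n_gt1; apply: (@fermat_initial_degree n 2 2 0 0 2 0 0) => //;
  try first [by lia | by split; lia].
move=> f f0; have [mu [mu_uniq mu_size mu_root]] := unity_roots (ltnW n_gt1).
exact: (fermat_bound2 (ltnW n_gt1) mu_uniq mu_size mu_root).
Qed.

Lemma initial_degree_pow2 n : (1 < n)%N ->
  initial_degree (ideal_pow (I n) 2) (2 * (n + 1))%N.
Proof.
move=> n_gt1; split; last first.
  by move=> e f If; apply: (initial_degree_sym2 n_gt1).2; apply: sub_symbolic_pow.
exists (('X_ord0 * diff_pow F n ord0) ^+ 2); split.
- by apply: ideal_powX; apply: fermat_gen.
- by rewrite expf_neq0 // mulf_neq0 ?mpolyX_neq0 ?diff_pow_neq0.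
rewrite mulnC addnC; apply: dhomogMn; apply: dhomogM; last exact: diff_pow_homog.
by rewrite dhomogX; apply/eqP; exact: mdeg1.
Qed.

(** With equal multiplicities [fermat2_bound] gives degree at least 5m/2; the hypothesis on [d]
    encodes rounding up. *)
Lemma fermat2_bound_half m d (f : {mpoly F[3]}) : (2 * d <= 5 * m + 1)%N -> f != 0 ->
  vanish_fermat 2 m m f -> (d < msize f)%N.
Proof.
move=> dm f0 fv; have [mu [mu_uniq mu_size mu_root]] := @unity_roots 2 isT.
have arith M : (0 < M)%N -> (2 * m + 3 * m <= 2 * M.-1)%N -> (d < M)%N by lia.
apply: arith; first by rewrite lt0n msize_poly_eq0.
exact: (@fermat2_bound _ 2 mu isT mu_uniq mu_size mu_root _ _ _ erefl f0 fv).
Qed.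

Lemma initial_degree2_even k : (2 <= k)%N ->
  initial_degree (symbolic_pow (I 2) (2 * k)%N) (5 * k)%N.
Proof.
(* The exponents make every multiplicity constraint an equality; for odd [k], which is then at least
   3, the factor y z corrects the parity. *)
move=> k2; have [ko|ke] := boolP (odd k).
  have kE : k = (2 * (k./2 - 1) + 3)%N by lia.
  move: (k./2 - 1)%N kE => t kE.
  apply: (@fermat_initial_degree 2 _ (2 * t + 1) 1 1 (2 * t + 2) (t + 2) (t + 2)) => //;
    try first [by lia | by split; lia].
  by move=> f f0; apply: fermat2_bound_half => //; lia.
have kE : k = (2 * k./2)%N by lia.
move: (k./2)%N kE => t kE.
apply: (@fermat_initial_degree 2 _ (2 * t) 0 0 (2 * t) t t) => //;
  try first [by lia | by split; lia].
by move=> f f0; apply: fermat2_bound_half => //; lia.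
Qed.

Lemma initial_degree2_odd k :
  initial_degree (symbolic_pow (I 2) (2 * k + 1)%N) (5 * k + 3)%N.
Proof.
have bound (f : {mpoly F[3]}) : f != 0 ->
    vanish_fermat 2 (2 * k + 1) (2 * k + 1) f -> (5 * k + 3 < msize f)%N.
  by move=> f0; apply: fermat2_bound_half => //; lia.
have [k2|k2] := leqP 2 k; last first.
  (* The forms are x (y^2-z^2) for m = 1 and x y (y^2-z^2)(z^2-x^2)(x^2-y^2) for m = 3. *)
  case: k bound k2 => [|[|//]] bound _.
    exact: (@fermat_initial_degree 2 _ 1 0 0 1 0 0).
  exact: (@fermat_initial_degree 2 _ 1 1 0 1 1 1).
(* From here on, the form for the even power 2k is multiplied by the generator x (y^2-z^2). *)
have [ko|ke] := boolP (odd k).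
  have kE : k = (2 * (k./2 - 1) + 3)%N by lia.
  move: (k./2 - 1)%N kE => t kE.
  by apply: (@fermat_initial_degree 2 _ (2 * t + 2) 1 1 (2 * t + 3) (t + 2) (t + 2)) => //;
    first [lia | split; lia].
have kE : k = (2 * k./2)%N by lia.
move: (k./2)%N kE => t kE.
by apply: (@fermat_initial_degree 2 _ (2 * t + 1) 0 0 (2 * t + 1) t t) => //;
  first [lia | split; lia].
Qed.

(** Without coordinate factors the extremal form has degree exactly mn, which meets the bound from a
    single pencil. *)
Lemma initial_degree_mul n m a b c : (1 < n)%N -> (a + b + c = m)%N ->
  [/\ m <= n * a, m <= n * b & m <= n * c]%N ->
  initial_degree (symbolic_pow (I n) m) (m * n)%N.
Proof.
move=> n_gt1 mE [ma mb mc].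
apply: (@fermat_initial_degree n m 0 0 0 a b c) => //; rewrite ?mE // ?add0n ?[(n * m)%N]mulnC //.
by move=> f f0; apply: mul_bound => //; exact: ltnW.
Qed.

Lemma initial_degree3 r k : (0 < r <= 2)%N ->
  initial_degree (symbolic_pow (I 3) (3 * k + r)%N) (9 * k + 4 * r)%N.
Proof.
(* The form is (D_0 D_1 D_2)^k times the r-th power of the generator x D_0. *)
move=> r12; apply: (@fermat_initial_degree 3 _ r 0 0 (k + r) k k) => //;
  try first [by lia | by split; lia].
move=> f f0; have [mu [mu_uniq mu_size mu_root]] := @unity_roots 3 isT.
exact: (@fermat3_bound _ 3 mu isT mu_uniq mu_size mu_root r k f).
Qed.

Lemma initial_degree4_5 : initial_degree (symbolic_pow (I 4) 5) 21.
Proof.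
(* A single z^4-x^4 gives only order 4 at the second coordinate point; the factor x supplies the
   missing order. *)
apply: (@fermat_initial_degree 4 5 1 0 0 2 1 2) => // f f0.
have [mu [mu_uniq mu_size mu_root]] := @unity_roots 4 isT.
exact: (@fermat4_bound _ 4 mu isT mu_uniq mu_size mu_root f).
Qed.

(** The exponents split m as evenly as possible, so the smallest is the floor of m/3. For m at least
    3, four times this floor is below m only when m = 5, and five times it never is. *)
Lemma initial_degree_ge4 n m : (4 <= n)%N -> (3 <= m)%N -> (4 < n)%N \/ m <> 5%N ->
  initial_degree (symbolic_pow (I n) m) (m * n)%N.
Proof.
move=> n4 m3 nm.
apply: (@initial_degree_mul n m (m %/ 3) ((m + 1) %/ 3) ((m + 2) %/ 3)); [by lia|by lia|].
have nq q : (m %/ 3 <= q)%N -> (m <= n * q)%N.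
  move=> mq; apply: (@leq_trans (n * (m %/ 3))); last by rewrite leq_mul2l mq orbT.
  have n4q : (4 * (m %/ 3) <= n * (m %/ 3))%N by rewrite leq_mul2r n4 orbT.
  case: nm => [n5|m5]; last by lia.
  have n5q : (5 * (m %/ 3) <= n * (m %/ 3))%N by rewrite leq_mul2r n5 orbT.
  by lia.
by split; apply: nq; lia.
Qed.

End InitialDegrees.

Theorem theorem1p1 (R : realType) :
  let I : nat -> set {mpoly R[i][3]} := fermat_ideal (R[i] : fieldType) in
  (forall n : nat, (2 <= n)%N ->
     initial_degree (symbolic_pow (I n) 2) (2 * (n + 1))%N /\
     initial_degree (ideal_pow (I n) 2) (2 * (n + 1))%N) /\
  (forall k : nat, (2 <= k)%N ->
     initial_degree (symbolic_pow (I 2%N) (2 * k)%N) (5 * k)%N) /\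
  (forall k : nat,
     initial_degree (symbolic_pow (I 2%N) (2 * k + 1)%N) (5 * k + 3)%N) /\
  (forall k : nat, (1 <= k)%N ->
     initial_degree (symbolic_pow (I 3%N) (3 * k)%N) (9 * k)%N) /\
  (forall k : nat, (1 <= k)%N ->
     initial_degree (symbolic_pow (I 3%N) (3 * k + 1)%N) (9 * k + 4)%N) /\
  (forall k : nat, (1 <= k)%N ->
     initial_degree (symbolic_pow (I 3%N) (3 * k + 2)%N) (9 * k + 8)%N) /\
  ((forall m : nat, (3 <= m)%N -> m <> 5%N ->
      initial_degree (symbolic_pow (I 4%N) m) (4 * m)%N) /\
   initial_degree (symbolic_pow (I 4%N) 5%N) 21%N) /\
  (forall n : nat, (5 <= n)%N -> forall m : nat, (3 <= m)%N ->
     initial_degree (symbolic_pow (I n) m) (m * n)%N).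
Proof.
move=> I; refine (conj _ (conj _ (conj _ (conj _ (conj _ (conj _ (conj (conj _ _) _))))))).
- by move=> n n2; split; [exact: initial_degree_sym2|exact: initial_degree_pow2].
- exact: initial_degree2_even.
- exact: initial_degree2_odd.
- move=> k k1; have -> : (9 * k = 3 * k * 3)%N by lia.
  by apply: (@initial_degree_mul _ 3 _ k k k) => //; first [lia | split; lia].
- by move=> k _; apply: (@initial_degree3 _ 1).
- by move=> k _; apply: (@initial_degree3 _ 2).
- by move=> m m3 m5; rewrite mulnC; apply: initial_degree_ge4 => //; right.
- exact: initial_degree4_5.
- by move=> n n5 m m3; apply: initial_degree_ge4 => //; [exact: ltnW|left].
Qed.
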